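(* Let $n\ge 1$, $p\in\{1,\dots,n\}$ and $k\ge 0$ be integers with $p+1\le n-k$, let $A_0,A_1,\dots,A_k\in\mathbb{R}^{p\times n}$, and let $a_i^l\in\mathbb{R}\cup\{-\infty\}$, $a_i^u\in\mathbb{R}\cup\{+\infty\}$ for $i=1,\dots,k$. Let $X^*\in E_{n,p,k}$ satisfy the linear independence constraint qualification (LICQ) and the first- and second-order necessary optimality conditions for (LPS), regarded as a smooth nonlinear program in $\mathbb{R}^{n\times p}$. Then $X^*$ is a global minimizer of (LPS).
   Context: Notation: $\mathrm{tr}(\cdot)$ is the trace, $I_m$ the identity matrix of order $m$, $\mathbb{S}^p$ the set of real symmetric $p\times p$ matrices, $\mathrm{vec}(\cdot)$ stacks the columns of a matrix, $\otimes$ is the Kronecker product, $X_i$ denotes the $i$-th column of a matrix $X$, $\delta_{ij}$ is the Kronecker delta, and for $\lambda\in\mathbb{R}$, $\lambda^+=\max\{0,\lambda\}$, $\lambda^-=\max\{0,-\lambda\}$. Problem (LPS): minimize $\mathrm{tr}(A_0X)$ over $X\in E_{n,p,k}=\{X\in\mathbb{R}^{n\times p}: X^TX=I_p,\ a_i^l\le \mathrm{tr}(A_iX)\le a_i^u,\ i=1,\dots,k\}$. It is viewed as a nonlinear program with the $p(p+1)/2$ equality constraints $X_i^TX_j=\delta_{ij}$ ($1\le i\le j\le p$) and the linear constraints $a_i^l\le\mathrm{tr}(A_iX)\le a_i^u$. For $X^*\in E_{n,p,k}$ the active index set is $\mathcal{A}=\{i: \mathrm{tr}(A_iX^* )=a_i^l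 \text{ or } \mathrm{tr}(A_iX^* )=a_i^u\}$. LICQ at $X^*$: the gradients at $X^*$ of the functions $X\mapsto X_i^TX_j$ ($1\le i\le j\le p$) together with the gradients $A_i^T$, $i\in\mathcal{A}$ (each counted once), are linearly independent in $\mathbb{R}^{n\times p}$. First-order (KKT) condition at $X^*$: there exist $\lambda_1,\dots,\lambda_k\in\mathbb{R}$ and $\Lambda\in\mathbb{S}^p$ such that $A_0^T+\sum_{i=1}^k\lambda_iA_i^T+X^*\Lambda=0$ and $\lambda_i^+(\mathrm{tr}(A_iX^* )-a_i^u)=\lambda_i^-(\mathrm{tr}(A_iX^* )-a_i^l)=0$ for $i=1,\dots,k$ (with the convention that if $a_i^u=+\infty$ the condition means $\lambda_i^+=0$, and if $a_i^l=-\infty$ it means $\lambda_i^-=0$). Second-order necessary condition at $X^*$ (with these multipliers): $\mathrm{vec}(V)^T(\Lambda\otimes I_n)\mathrm{vec}(V)\ge 0$ for every $V\in\mathbb{R}^{n\times p}$ such that $\mathrm{tr}(A_iV)=0$ for all $i\in\mathcal{A}$ and $V_i^TX_j^*+V_j^TX_i^*=0$ for all $1\le i\le j\le p$. *)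

(* Defs.v *)
From HB Require Import structures.
From mathcomp Require Import all_boot all_order all_algebra.
From mathcomp Require Import all_classical all_reals all_analysis.
From mathcomp Require Import mxtens ring.

Set Implicit Arguments.
Unset Strict Implicit.
Unset Printing Implicit Defensive.

Import Order.TTheory GRing.Theory Num.Theory.
Import numFieldNormedType.Exports.
Local Open Scope classical_set_scope.
Local Open Scope ring_scope.

(* Euclidean gradient of f at X, i.e., the matrix of partial derivatives. *)
Definition grad (R : realType) (n p : nat) (f : 'M[R]_(n, p) -> R)
    (X : 'M[R]_(n, p)) : 'M[R]_(n, p) :=
  \matrix_(a < n, b < p) 'D_(delta_mx a b) f X.

Definition gram (R : realType) (n p : nat) (i j : 'I_p) (X : 'M[R]_(n, p)) : R :=
  ((col i X)^T *m col j X) 0 0.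

(* mxvec is row-major, so transposing first stacks the columns. *)
Definition vec (R : realType) (n p : nat) (V : 'M[R]_(n, p)) : 'cV[R]_(p * n) :=
  (mxvec V^T)^T.

(* The numbering of the entries of vec agrees with that of *t. *)
Lemma mxvec_indexE m n (i : 'I_m) (j : 'I_n) : mxvec_index i j = mxtens_index (i, j) :> nat.
Proof.
rewrite /mxvec_index /= /enum_rank /= enum_rank_in.unlock /= insubdK; last first.
  by rewrite -topredE /= cardE index_mem mem_enum.
rewrite enumT /= unlock /= /prod_enum.
have H (s : seq 'I_m) : uniq s -> i \in s -> index (i,j) [seq (x1,x2) | x1 <- s, x2 <- enum 'I_n] = (index i s * n + j)%N.
  elim: s => //= x s IH /andP[xs us]; rewrite inE index_cat => /orP[/eqP<-|is_].
    rewrite eqxx map_f ?mem_enum// index_map ?index_enum_ord ?mul0n//; by move=> ? ? [].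
  rewrite (negbTE (_ : (i,j) \notin _)); last first.
    apply/mapP => -[y _ [e _]]; by rewrite -e is_ in xs.
  rewrite IH// size_map size_enum_ord; case: eqP => [e|_]; first by rewrite e is_ in xs.
  by rewrite mulSn addnA.
by rewrite (H (enum 'I_m)) ?enum_uniq ?mem_enum// index_enum_ord.
Qed.

Lemma vecE (R : realType) n p (V : 'M[R]_(n,p)) i j : vec V (mxtens_index (j, i)) 0 = V i j.
Proof.
rewrite /vec mxE.
have -> : mxtens_index (j,i) = mxvec_index j i by apply: ord_inj; rewrite mxvec_indexE.
by rewrite mxvecE !mxE.
Qed.

Lemma derive_poly (R : realType) n p (f : 'M[R]_(n,p) -> R) X V c d :
  (forall h, f (h *: V + X) = f X + h * c + h ^+ 2 * d) -> 'D_V f X = c.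
Proof.
move=> H; rewrite /derive; apply: cvg_lim => //.
have : (fun h : R => c + h * d) @ 0^' --> c.
  rewrite -[X in _ --> X](addr0 c) -[X in _ --> _ + X](mul0r d).
  apply: cvgD; first exact: cvg_cst.
  apply: cvgMl. exact: nbhs_dnbhs.
apply: cvg_trans; apply: near_eq_cvg.
near=> h. 
have Hs : (f \o shift X) (h *: V) = f X + h * c + h ^+ 2 * d by exact: H.
rewrite Hs.
have h0 : h != 0 by near: h; exact: nbhs_dnbhs_neq.
by rewrite /GRing.scale /=; field.
Unshelve. all: by end_near.
Qed.

Lemma grad_tr (R : realType) n p (A : 'M[R]_(p, n)) X : grad (fun Y => \tr (A *m Y)) X = A^T.
Proof.
apply/matrixP => a b; rewrite !mxE.
apply: (@derive_poly _ _ _ _ _ _ _ 0) => h.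
rewrite mulmxDr mxtraceD -scalemxAr mxtraceZ mulr0 addr0 addrC.
congr (_ + _ * _).
rewrite /mxtrace (bigD1 b)//= big1 ?addr0; last first.
  move=> j jb; rewrite mxE big1// => k _; by rewrite mxE (negbTE jb) andbF mulr0.
rewrite mxE (bigD1 a)//= big1 ?addr0 ?mxE ?eqxx ?mulr1// => k ka.
by rewrite mxE (negbTE ka) mulr0.
Qed.

Lemma grad_gram (R : realType) n p (i j : 'I_p) (X : 'M[R]_(n,p)) :
  grad (gram i j) X = col j X *m delta_mx 0 i + col i X *m delta_mx 0 j.
Proof.
apply/matrixP => a b; rewrite !mxE !big_ord1 !mxE.
apply: (@derive_poly _ _ _ _ _ _ _ ((b == i)%:R * (b == j)%:R)) => h.
rewrite /gram !mxE /=.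
rewrite (bigD1 a)//= [X in _ = X + _ + _](bigD1 a)//= !mxE !eqxx /=.
rewrite (eq_bigr (fun k => (col i X)^T 0 k * col j X k 0)); last first.
  by move=> k ka; rewrite !mxE (negbTE ka) mulr0 !add0r.
by rewrite ![_ == b]eq_sym; ring.
Qed.

(* The bounds al i and au i live in \bar R; membership of al i in
   R `|` {-oo} and of au i in R `|` {+oo} is assumed in the theorem. *)
Definition feasible (R : realType) (n p k : nat) (A : 'I_k -> 'M[R]_(p, n))
    (al au : 'I_k -> \bar R) : set 'M[R]_(n, p) :=
  [set X | X^T *m X = 1%:M /\
    forall i, (al i <= (\tr (A i *m X))%:E)%E /\
              ((\tr (A i *m X))%:E <= au i)%E].

Definition active (R : realType) (n p k : nat) (A : 'I_k -> 'M[R]_(p, n))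
    (al au : 'I_k -> \bar R) (X : 'M[R]_(n, p)) : {set 'I_k} :=
  [set i | ((\tr (A i *m X))%:E == al i) || ((\tr (A i *m X))%:E == au i)]%SET.

(* [free] is linear independence of a family (repeated vectors make it fail),
   so each active i contributes once, even when al i = au i. *)
Definition LICQ (R : realType) (n p k : nat) (A : 'I_k -> 'M[R]_(p, n))
    (al au : 'I_k -> \bar R) (X : 'M[R]_(n, p)) : Prop :=
  free ([seq grad (gram ij.1 ij.2) X
           | ij <- enum [pred ij : 'I_p * 'I_p | (ij.1 <= ij.2)%N]] ++
        [seq grad (fun Y => \tr (A i *m Y)) X
           | i <- enum (active A al au X)]).

(* The complementarity products are taken in \bar R, where 0 * -oo = 0 and
   r * -oo = -oo for r > 0: for au i = +oo the first one says exactly that the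
   positive part of lambda i is 0, and dually for al i = -oo. *)
Definition first_order (R : realType) (n p k : nat) (A0 : 'M[R]_(p, n))
    (A : 'I_k -> 'M[R]_(p, n)) (al au : 'I_k -> \bar R) (X : 'M[R]_(n, p))
    (lambda : 'I_k -> R) (Lambda : 'M[R]_p) : Prop :=
  A0^T + \sum_(i < k) lambda i *: (A i)^T + X *m Lambda = 0 /\
  forall i,
    ((Num.max 0 (lambda i))%:E * ((\tr (A i *m X))%:E - au i) = 0)%E /\
    ((Num.max 0 (- lambda i))%:E * ((\tr (A i *m X))%:E - al i) = 0)%E.

(* [*t] is the Kronecker product. *)
Definition second_order (R : realType) (n p k : nat)
    (A : 'I_k -> 'M[R]_(p, n)) (al au : 'I_k -> \bar R) (X : 'M[R]_(n, p))
    (Lambda : 'M[R]_p) : Prop :=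
  forall V : 'M[R]_(n, p),
    (forall i, i \in active A al au X -> \tr (A i *m V) = 0) ->
    (forall i j : 'I_p, (i <= j)%N ->
       (col i V)^T *m col j X + (col j V)^T *m col i X = 0) ->
    0 <= ((vec V)^T *m (Lambda *t (1%:M : 'M[R]_n)) *m vec V) 0 0.

Definition global_minimizer (T : Type) (R : realType) (f : T -> R) (E : set T)
    (x : T) : Prop :=
  E x /\ forall y, E y -> f x <= f y.

(* Main.v *)
Require Import Defs.
From HB Require Import structures.
From mathcomp Require Import all_boot all_order all_algebra.
From mathcomp Require Import all_classical all_reals all_analysis.
From mathcomp Require Import mxtens lra.

Import Order.TTheory GRing.Theory Num.Theory.
Import numFieldNormedType.Exports.
Local Open Scope classical_set_scope.
Local Open Scope ring_scope.

(** The Lagrangian Y |-> tr (A0 Y) + sum_i lambda_i tr (A_i Y) + tr (Lambda X^T Y)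
    vanishes identically, by stationarity.  Hence, for feasible Y,
<<
  tr (A0 Y) - tr (A0 X)
    = sum_i lambda_i (tr (A_i X) - tr (A_i Y)) + tr (Lambda (I - X^T Y)).
>>
    Complementarity makes every term of the sum nonnegative
    ([complementarity_ge0]).  Since X and Y both have orthonormal columns,
    (Y - X)^T (Y - X) = 2 I - X^T Y - Y^T X, so that the last term is half of
    tr ((Y - X) Lambda (Y - X)^T) ([trace_orthonormal_diff]).  It remains to see
    that Lambda is positive semidefinite, which is where the dimensions enter:
    given a row vector u, the p + k < n linear equations w X = 0 and
    w (u A_i)^T = 0 have a solution w != 0, and the rank-one direction V = w^T u
    is tangent to all the active constraints.  The second-order condition along V reads
    |w|^2 (u Lambda u^T) >= 0 ([second_order_psd]). *)

Lemma exists_left_kernel (F : fieldType) (n m : nat) (B : 'M[F]_(n, m)) :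
  (m < n)%N -> exists2 w : 'rV[F]_n, w != 0 & w *m B = 0.
Proof.
move=> mn; have : kermx B != 0.
  by rewrite -mxrank_eq0 mxrank_ker -lt0n subn_gt0 (leq_ltn_trans (rank_leq_col B)).
by move=> /rowV0Pn[w /sub_kermxP wB w0]; exists w.
Qed.

Lemma row_dot_gt0 (R : realDomainType) (n : nat) (w : 'rV[R]_n) :
  w != 0 -> 0 < (w *m w^T) 0 0.
Proof.
move=> /rV0Pn[a wa]; rewrite mxE (bigD1 a)//= mxE ltr_pwDl//.
  by rewrite -expr2 exprn_even_gt0.
by apply: sumr_ge0 => b _; rewrite mxE -expr2 sqr_ge0.
Qed.

Lemma trace_conj_ge0 (R : realDomainType) (n p : nat) (L : 'M[R]_p)
    (D : 'M[R]_(n, p)) :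
  (forall u : 'rV[R]_p, 0 <= (u *m L *m u^T) 0 0) -> 0 <= \tr (D *m L *m D^T).
Proof.
move=> L0; apply: sumr_ge0 => a _; have := L0 (row a D).
by rewrite -row_mul !mxE; under eq_bigr do rewrite !mxE;
  under [in X in _ -> X]eq_bigr do rewrite !mxE.
Qed.

Lemma sum_mxtens_index (R : nmodType) (m n : nat) (F : 'I_(m * n) -> R) :
  \sum_c F c = \sum_(i < m) \sum_(j < n) F (mxtens_index (i, j)).
Proof.
rewrite pair_big /= (reindex (@mxtens_index m n)) /=.
  by apply: eq_bigr => -[].
by apply: onW_bij; exists (@mxtens_unindex m n);
  [exact: mxtens_indexK | exact: mxtens_unindexK].
Qed.

Lemma vec_kron_quadratic (R : realType) (n p : nat) (V : 'M[R]_(n, p))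
    (L : 'M[R]_p) :
  ((vec V)^T *m (L *t (1%:M : 'M[R]_n)) *m vec V) 0 0 = \tr (V *m L *m V^T).
Proof.
rewrite mxE sum_mxtens_index exchange_big /=.
apply: eq_bigr => a _; rewrite mxE; apply: eq_bigr => l _.
rewrite vecE [V^T l a]mxE; congr (_ * _).
rewrite mxE sum_mxtens_index [RHS]mxE.
apply: eq_bigr => j _; rewrite (bigD1 a)//= big1 ?addr0 => [|b ba].
  by rewrite mxE vecE tensmxE mxE eqxx mulr1.
by rewrite tensmxE [1%:M b a]mxE (negbTE ba) !mulr0.
Qed.

(** Only directions of rank one are needed to recover the sign of the multiplier:
    along V = w^T u the tangency conditions are linear in w for fixed u, and there
    are fewer of them than coordinates of w. *)
Lemma second_order_psd (R : realType) (n p k : nat) (A : 'I_k -> 'M[R]_(p, n))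
    (al au : 'I_k -> \bar R) (X : 'M[R]_(n, p)) (L : 'M[R]_p) :
  (p + k < n)%N -> second_order A al au X L ->
  forall u : 'rV[R]_p, 0 <= (u *m L *m u^T) 0 0.
Proof.
move=> pkn so u.
pose B := row_mx X (\matrix_(a, i) (u *m A i) 0 a).
have [w w0 wB] := @exists_left_kernel _ _ _ B pkn.
move: wB; rewrite mul_mx_row -row_mx0 => /eq_row_mx[wX wA].
have colV i : col i (w^T *m u) = u 0 i *: w^T.
  by apply/matrixP => a b; rewrite !mxE big_ord1 !mxE mulrC [b]ord1.
have VX i j : (col i (w^T *m u))^T *m col j X = 0.
  by rewrite colV linearZ /= trmxK -scalemxAl [col j X]colE mulmxA wX mul0mx scaler0.
have VA i : \tr (A i *m (w^T *m u)) = 0.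
  have /matrixP/(_ 0 i) := wA; rewrite !mxE => wAi.
  rewrite mulmxA mxtrace_mulC mulmxA /mxtrace big_ord1 mxE -[RHS]wAi.
  by apply: eq_bigr => a _; rewrite !mxE mulrC.
have : 0 <= \tr (w^T *m u *m L *m (w^T *m u)^T).
  rewrite -vec_kron_quadratic; apply: so => [i _|i j _]; first exact: VA.
  by rewrite !VX addr0.
have -> : w^T *m u *m L *m (w^T *m u)^T = w^T *m (u *m L *m u^T *m w).
  by rewrite trmx_mul trmxK !mulmxA.
rewrite mxtrace_mulC -(mulmxA _ w) /mxtrace big_ord1 mxE big_ord1.
by rewrite pmulr_lge0 ?row_dot_gt0.
Qed.

(** A positive multiplier forces s = u and a negative one s = l, so moving from s
    to any t in [l, u] changes the term only in the favourable direction.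
    The bound +oo (resp. -oo) excludes the corresponding sign. *)
Lemma complementarity_ge0 (R : realType) (c s t : R) (l u : \bar R) :
  ((Num.max 0 c)%:E * (s%:E - u) = 0)%E ->
  ((Num.max 0 (- c))%:E * (s%:E - l) = 0)%E ->
  (l <= t%:E)%E -> (t%:E <= u)%E -> 0 <= c * (s - t).
Proof.
move=> cu cl lt tu; have [c0|c0|->] := ltgtP c 0; last by rewrite mul0r.
  have Nc0 : 0 < - c by rewrite oppr_gt0.
  move: cl; rewrite (max_r (ltW Nc0)) => /eqP; rewrite mule_eq0 eqe (gt_eqF Nc0)//=.
  case: l lt => [l||]//; rewrite lee_fin => lt; rewrite -EFinB eqe => /eqP sl.
  by rewrite nmulr_rge0//; lra.
move: cu; rewrite (max_r (ltW c0)) => /eqP; rewrite mule_eq0 eqe (gt_eqF c0)//=.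
case: u tu => [u||]//; rewrite lee_fin => tu; rewrite -EFinB eqe => /eqP su.
by rewrite pmulr_rge0//; lra.
Qed.

(** Expanding the quadratic form on the left, orthonormality of the columns makes
    both square terms constant, and symmetry of L merges the two cross terms: this
    is what turns the sign of L into a statement about a linear objective. *)
Lemma trace_orthonormal_diff (R : realType) (n p : nat) (L : 'M[R]_p)
    (X Y : 'M[R]_(n, p)) :
  L^T = L -> X^T *m X = 1%:M -> Y^T *m Y = 1%:M ->
  \tr ((Y - X) *m L *m (Y - X)^T) = 2 * (\tr L - \tr (L *m X^T *m Y)).
Proof.
move=> Ls XX YY.
have YX : \tr (L *m (Y^T *m X)) = \tr (L *m X^T *m Y).
  by rewrite -mxtrace_tr !trmx_mul trmxK Ls -mulmxA mxtrace_mulC -mulmxA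
    [RHS]mxtrace_mulC mulmxA mxtrace_mulC.
have -> : \tr ((Y - X) *m L *m (Y - X)^T) = \tr (L *m ((Y - X)^T *m (Y - X))).
  by rewrite -mulmxA mxtrace_mulC mulmxA.
have -> : (Y - X)^T *m (Y - X) = 1%:M - Y^T *m X - (X^T *m Y - 1%:M).
  by rewrite [(Y - X)^T]linearB /= mulmxBl !mulmxBr XX YY.
rewrite !mulmxBr !mulmx1 [L *m (X^T *m Y)]mulmxA !(raddfB (@mxtrace R p)) /= YX; lra.
Qed.

Theorem theorem5p4 (R : realType) (n p k : nat)
    (hn : (1 <= n)%N) (hp : (1 <= p <= n)%N) (hk : (p + 1 <= n - k)%N)
    (A0 : 'M[R]_(p, n)) (A : 'I_k -> 'M[R]_(p, n))
    (al au : 'I_k -> \bar R)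
    (hal : forall i, al i != +oo%E) (hau : forall i, au i != -oo%E)
    (X : 'M[R]_(n, p))
    (hX : feasible A al au X)
    (hLICQ : LICQ A al au X)
    (hopt : exists (lambda : 'I_k -> R) (Lambda : 'M[R]_p),
        [/\ Lambda^T = Lambda,
            first_order A0 A al au X lambda Lambda &
            second_order A al au X Lambda]) :
  global_minimizer (fun Y : 'M[R]_(n, p) => \tr (A0 *m Y))
    (feasible A al au) X.
Proof.
split=> // Y [YY Ybounds]; case: hX => XX _.
have [lambda [L [Ls [stat compl] so]]] := hopt.
have pkn : (p + k < n)%N.
  by move: hk; rewrite addn1 ltn_subRL addnC.
have trA0 Z : \tr (A0 *m Z) =
    - (\sum_i lambda i * \tr (A i *m Z)) - \tr (L *m X^T *m Z).
  have /(congr1 trmx) : A0^T = - (\sum_i lambda i *: (A i)^T) - X *m L.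
    by apply/eqP; rewrite -opprD -addr_eq0 addrA stat.
  rewrite trmxK => ->; rewrite linearB linearN /= trmx_mul Ls linear_sum /=.
  rewrite mulmxBl mulNmx (raddfB (@mxtrace R p)) (raddfN (@mxtrace R p)) /=
    mulmx_suml (raddf_sum (@mxtrace R p)) /=.
  congr (- _ - _); apply: eq_bigr => i _.
  by rewrite linearZ /= trmxK -scalemxAl mxtraceZ.
have sum_ge0 : 0 <= \sum_i lambda i * (\tr (A i *m X) - \tr (A i *m Y)).
  apply: sumr_ge0 => i _; have [cu cl] := compl i; have [lY uY] := Ybounds i.
  exact: complementarity_ge0 cu cl lY uY.
have := @trace_conj_ge0 _ _ _ L (Y - X) (@second_order_psd _ _ _ _ A al au X L pkn so).
rewrite trace_orthonormal_diff// => quad_ge0.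
move: sum_ge0; under eq_bigr do rewrite mulrBr.
rewrite sumrB /= !trA0 -[L *m X^T *m X]mulmxA XX mulmx1; lra.
Qed.
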